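(* Consider testing $H_0:\|v\|_1\le\epsilon_0$ versus $H_1:\|v\|_1\ge\epsilon_1$ in the Gaussian sequence model, and let $T_2(X)=\|X\|_2^2-E_{P_0}\|X\|_2^2$. (1) There is a decision threshold $t_*$ such that the chi-squared test $\psi(X)=I(T_2(X)\ge t_* )$ is valid, and there are positive constants $C_1$ and $K_1$ depending only on $\alpha,\beta$ such that this test is powerful whenever $$\epsilon_1-\epsilon_0\ge K_1\,\sigma\, d^{3/4}\quad\text{and}\quad\epsilon_0\le C_1\,\sigma\, d^{1/4}.$$ (2) However, there is a positive constant $C_2$ such that for $\epsilon_1-\epsilon_0\asymp\sigma d^{3/4}$ and $C_2\,\sigma\, d^{1/4}\le\epsilon_0\lesssim\sigma d^{3/4}$, there exists no decision threshold $t$ such that the chi-squared test $\psi(X)=I(T_2(X)\ge t)$ is both valid and powerful. Here the hidden constants in $\asymp$ and $\lesssim$ are fixed, and $C_2$ may depend on them and on $\alpha,\beta$.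
   Context: Fix $\alpha\in(0,1)$ and $\beta\in(0,1-\alpha)$. For an integer $d\ge1$, $\sigma\in(0,1]$ and $v\in\mathbb{R}^d$ let $P_v=\mathcal N(v,\sigma^2 I_d)$; one observes a single $X\sim P_v$. For $0\le\epsilon_0\le\epsilon_1$, a test is a measurable map $\psi:\mathbb{R}^d\to\{0,1\}$ (value $1$ means rejecting $H_0$). It is valid if $\sup_{\|v\|_1\le\epsilon_0}P_v(\psi(X)=1)\le\alpha$, and powerful if $\sup_{\|v\|_1\ge\epsilon_1}P_v(\psi(X)=0)\le\beta$. The thresholds $t_*$ and $t$ are numbers that may depend on $\epsilon_0,\epsilon_1,\sigma,d,\alpha,\beta$ but not on $v$ or $X$. *)

(* Defs.v *)
From HB Require Import structures.
From mathcomp Require Import all_boot all_order all_algebra.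
From mathcomp Require Import all_classical all_reals all_analysis measurable_realfun.

Set Implicit Arguments.
Unset Strict Implicit.
Unset Printing Implicit Defensive.

Import Order.TTheory GRing.Theory Num.Theory.
Import numFieldNormedType.Exports.

Local Open Scope classical_set_scope.
Local Open Scope ring_scope.

Section product_probability.
Context d (T : measurableType d) (R : realType).

Definition tuple_cons n (x : T * n.-tuple T) : n.+1.-tuple T :=
  [tuple of x.1 :: x.2].

Let measurable_tuple_cons n : measurable_fun setT (@tuple_cons n).
Proof. exact: measurable_cons. Qed.

HB.instance Definition _ n := isMeasurableFun.Build _ _ _ _ (@tuple_cons n)
  (@measurable_tuple_cons n).

(* The product probability of P 0, ..., P (n - 1); it is the only one
   satisfying prod_probabilityE below. *)
Fixpoint prod_probability n :
    ('I_n -> probability T R) -> probability (n.-tuple T) R :=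
  match n return ('I_n -> probability T R) -> probability (n.-tuple T) R with
  | 0 => fun _ => dirac [tuple]
  | m.+1 => fun P =>
      distribution
        (P ord0 \x prod_probability (fun i => P (lift ord0 i)))%E
        (@tuple_cons m)
  end.

Lemma prod_probabilityE n (P : 'I_n -> probability T R) (A : 'I_n -> set T) :
  (forall i, measurable (A i)) ->
  prod_probability P [set x | forall i, A i (tnth x i)] =
  (\prod_(i < n) P i (A i))%E.
Proof.
elim: n P A => [|n IH] P A mA.
  rewrite big_ord0 /= diracE mem_set//=.
  by case.
rewrite big_ord_recl -IH// /= /distribution /pushforward.
rewrite -product_measure1E//; last first.
  rewrite [X in measurable X](_ : _ =
    \bigcap_(i in setT) ((@tnth n T ^~ i) @^-1` A (lift ord0 i))).
    apply: fin_bigcap_measurable => // i _.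
    by rewrite -[X in measurable X]setTI; exact: measurable_tnth.
  by apply/seteqP; split => [x Ax i _|x Ax i]; exact: Ax.
congr (_ _); apply/seteqP; split => -[x y] /=.
  move=> Axy; split => [|i]; first by have := Axy ord0; rewrite tnth0.
  by have := Axy (lift ord0 i); rewrite tnthS.
by move=> [Ax Ay] i; case: (unliftP ord0 i) => [j|] ->; rewrite ?tnth0 ?tnthS.
Qed.

End product_probability.

Section normalR.
Context (R : realType).

Let idTR : measurableTypeR R -> R := idfun.

#[local] HB.instance Definition _ := @isMeasurableFun.Build _ _ _ _ idTR
  (@measurable_id _ _ setT).

(* N(m, s^2); normal_prob takes the standard deviation. The measure is that of
   normal_prob: the pushforward along the identity only moves it from
   measurableTypeR R to R, whose display differs. *)
Definition normalR (m s : R) : probability R R :=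
  distribution (normal_prob m s) idTR.

Lemma normalRE (m s : R) : normalR m s = normal_prob m s :> (set R -> \bar R).
Proof. by []. Qed.

End normalR.

Section gaussian_sequence_model.
Context (R : realType) (d : nat).
Implicit Types (v x : d.-tuple R) (sigma eps t : R).

Definition l1norm v : R := \sum_(i < d) `|tnth v i|.

Definition sqnorm2 x : R := \sum_(i < d) tnth x i ^+ 2.

(* N(v, sigma^2 I_d) *)
Definition gauss v sigma : probability (d.-tuple R) R :=
  prod_probability (fun i => normalR (tnth v i) sigma).

Definition test := {mfun d.-tuple R >-> bool}.

Definition valid alpha sigma eps (psi : test) : Prop :=
  (ereal_sup [set gauss v sigma (psi @^-1` [set true]) |
     v in [set v | (l1norm v <= eps)%R]] <= alpha%:E)%E.

Definition powerful beta sigma eps (psi : test) : Prop :=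
  (ereal_sup [set gauss v sigma (psi @^-1` [set false]) |
     v in [set v | (eps <= l1norm v)%R]] <= beta%:E)%E.

(* The expectation is finite, equal to d * sigma^2, so fine loses nothing. *)
Definition T2 sigma x : R :=
  sqnorm2 x - fine 'E_(gauss [tuple 0 | _ < d] sigma)[sqnorm2].

Definition chi2 sigma t x : bool := t <= T2 sigma x.

Let measurable_chi2 sigma t : measurable_fun setT (chi2 sigma t).
Proof.
apply: measurable_fun_ler => //.
apply: measurable_funB => //.
apply: measurable_sum => i.
by apply: measurable_funX; exact: measurable_tnth.
Qed.

HB.instance Definition _ sigma t := isMeasurableFun.Build _ _ _ _
  (chi2 sigma t) (measurable_chi2 sigma t).

Definition chi2_test sigma t : test := chi2 sigma t.

End gaussian_sequence_model.

(* Main.v *)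
Require Import Defs.
From mathcomp Require Import all_boot all_order all_algebra.
From mathcomp Require Import all_classical all_reals all_analysis.
From mathcomp Require Import measurable_realfun ring lra.

(** Both halves of the theorem come from the mean and the variance of the
    statistic. Put N = ‖v‖₂² and let m2, m4 be the second and fourth moments of
    N(0, 1). Under P_v the squares X_i² are independent with mean
    v_i² + σ² m2 and variance 4 m2 σ² v_i² + (m4 - m2²) σ⁴, because the odd
    moments of N(0, 1) vanish. Hence T2 has mean N and, with w = σ d^(1/4), its
    variance is at most B w² (w² + N) for a constant B
    ([T2_second_moment_le]): w² is the natural unit of the problem. The values
    m2 = 1 and m4 = 3 only affect B, so they are left uncomputed.

    Chebyshev's inequality then says that the test rejects rarely when N <= r
    and the threshold exceeds r by a large multiple of w² + r
    ([chi2_rejection_le]), and accepts rarely when N is at least twice the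
    threshold and a large multiple of w² ([chi2_acceptance_le]).

    The l1 constraint enters through ‖v‖₂ <= ‖v‖₁ <= √d ‖v‖₂. Hence H0 gives
    N <= ε0², so t_* = ε0² + k (w² + ε0²) is valid for a large k. If ε0 <= w,
    this threshold is a multiple of w², while ‖v‖₁ >= K σ d^(3/4) forces
    N >= K² w²; so the test is powerful once K is large.

    For the negative half, the two norm inequalities are attained at opposite
    extremes. The null vector with all its mass ε0 on one coordinate has
    N = ε0² >= C2² w²; the alternative that spreads ε1 evenly has
    N = ε1² / d <= (c2 + c3)² w². When C2 is large the null vector produces the
    larger statistic by far. A threshold below half of ε0² rejects it with
    probability above α, hence is not valid; a higher one accepts the flat
    alternative with probability above β, hence is not powerful
    ([no_chi2_threshold]). *)

Set Implicit Arguments.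
Unset Strict Implicit.
Unset Printing Implicit Defensive.

Import Order.TTheory GRing.Theory Num.Theory.
Import numFieldNormedType.Exports.
Local Open Scope ring_scope.

(** * Integration against product probabilities *)

Section product_moments.
Local Open Scope classical_set_scope.
Context d (T : measurableType d) (R : realType).

Lemma ge0_integral_prod_probabilityS n (P : 'I_n.+1 -> probability T R)
    (f : n.+1.-tuple T -> \bar R) :
  measurable_fun setT f -> (forall x, 0 <= f x)%E ->
  (\int[prod_probability P]_x f x =
   \int[P ord0]_a \int[prod_probability (fun i => P (lift ord0 i))]_y
     f (tuple_cons (a, y)))%E.
Proof.
move=> mf f0.
rewrite [LHS](@ge0_integral_distribution _ _ _ _ _
  (P ord0 \x prod_probability (fun i => P (lift ord0 i)))%E
  (@tuple_cons _ T n)) //.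
rewrite fubini_tonelli1//.
- exact: measurableT_comp.
- by move=> x; exact: f0.
Qed.

Lemma sum_tuple_cons n (g : 'I_n.+1 -> T -> R) a (y : n.-tuple T) :
  \sum_(i < n.+1) g i (tnth (tuple_cons (a, y)) i) =
  g ord0 a + \sum_(i < n) g (lift ord0 i) (tnth y i).
Proof.
rewrite big_ord_recl tnth0; congr (_ + _).
by apply: eq_bigr => i _; rewrite tnthS.
Qed.

Lemma measurable_sum_tnth n (g : 'I_n -> T -> R) :
  (forall i, measurable_fun setT (g i)) ->
  measurable_fun setT (fun x : n.-tuple T => \sum_(i < n) g i (tnth x i)).
Proof.
move=> mg; apply: measurable_sum => i; apply: measurableT_comp => //.
exact: measurable_tnth.
Qed.

(** Linearity of the expectation. The additive constant [c] absorbs the first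
    coordinate, so that the induction needs no marginal laws and, all terms
    being nonnegative, no integrability. *)
Lemma ge0_integral_sum_tnth n (P : 'I_n -> probability T R)
    (g : 'I_n -> T -> R) (m : 'I_n -> R) :
  (forall i, measurable_fun setT (g i)) -> (forall i x, 0 <= g i x) ->
  (forall i, \int[P i]_x (g i x)%:E = (m i)%:E)%E ->
  forall c, 0 <= c ->
  (\int[prod_probability P]_x (c + \sum_(i < n) g i (tnth x i))%:E =
   (c + \sum_(i < n) m i)%:E)%E.
Proof.
elim: n P g m => [|n IH] P g m mg g0 gm c c0.
  under eq_integral do rewrite big_ord0.
  by rewrite integral_cst//= probability_setT mule1 big_ord0.
rewrite ge0_integral_prod_probabilityS; last 2 first.
- apply/measurable_EFinP; apply: measurable_funD => //.
  exact: measurable_sum_tnth.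
- by move=> x; rewrite lee_fin addr_ge0 ?sumr_ge0.
transitivity (\int[P ord0]_a
    ((c + \sum_(i < n) m (lift ord0 i))%:E + (g ord0 a)%:E))%E.
  apply: eq_integral => a _.
  under eq_integral do rewrite sum_tuple_cons addrA.
  rewrite (IH (fun i => P (lift ord0 i)) (fun i => g (lift ord0 i))
    (fun i => m (lift ord0 i))) ?addr_ge0//.
  by rewrite -EFinD addrAC.
have m0 i : 0 <= m i.
  by rewrite -lee_fin -gm integral_ge0// => x _; rewrite lee_fin.
rewrite ge0_integralD//; last 2 first.
- by move=> x _; rewrite lee_fin.
- exact/measurable_EFinP.
- rewrite integral_cst//= probability_setT mule1 gm -EFinD big_ord_recl.
  by congr EFin; ring.
- by move=> x _; rewrite lee_fin addr_ge0 ?sumr_ge0.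
Qed.

(** Additivity of the variance. Asking that the integral of (c + g)² be c² + s
    for every [c] says at once that g has mean 0 and variance s; it involves
    only integrals of nonnegative functions and is inherited by independent sums
    through Tonelli, so cross terms never appear. *)
Lemma integral_sqr_sum_tnth n (P : 'I_n -> probability T R) (g : 'I_n -> T -> R)
    (s : 'I_n -> R) :
  (forall i, measurable_fun setT (g i)) ->
  (forall i c, \int[P i]_x ((c + g i x) ^+ 2)%:E = (c ^+ 2 + s i)%:E)%E ->
  forall c,
  (\int[prod_probability P]_x ((c + \sum_(i < n) g i (tnth x i)) ^+ 2)%:E =
   (c ^+ 2 + \sum_(i < n) s i)%:E)%E.
Proof.
elim: n P g s => [|n IH] P g s mg gs c.
  under eq_integral do rewrite big_ord0.
  by rewrite integral_cst//= probability_setT mule1 big_ord0 !addr0.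
have s0 i : 0 <= s i.
  have := gs i 0; rewrite expr0n add0r => gi; rewrite -lee_fin -gi.
  by rewrite integral_ge0// => x _; rewrite lee_fin sqr_ge0.
rewrite ge0_integral_prod_probabilityS; last 2 first.
- apply/measurable_EFinP; apply: measurable_funX; apply: measurable_funD => //.
  exact: measurable_sum_tnth.
- by move=> x; rewrite lee_fin sqr_ge0.
transitivity (\int[P ord0]_a
    (((c + g ord0 a) ^+ 2)%:E + (\sum_(i < n) s (lift ord0 i))%:E))%E.
  apply: eq_integral => a _.
  under eq_integral do rewrite sum_tuple_cons addrA.
  by rewrite (IH (fun i => P (lift ord0 i)) (fun i => g (lift ord0 i))
    (fun i => s (lift ord0 i))).
rewrite ge0_integralD//; last 3 first.
- by move=> x _; rewrite lee_fin sqr_ge0.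
- apply/measurable_EFinP; apply: measurable_funX; exact: measurable_funD.
- by move=> x _; rewrite lee_fin sumr_ge0.
by rewrite gs integral_cst//= probability_setT mule1 -EFinD big_ord_recl addrA.
Qed.

End product_moments.

(** * Densities and the moments of the normal law *)

Section density.
Local Open Scope classical_set_scope.
Context d (T : measurableType d) (R : realType).
Variables (mu nu : {measure set T -> \bar R}) (g : T -> R).
Hypotheses (mg : measurable_fun setT g) (g0 : forall x, 0 <= g x).
Hypothesis nuE :
  forall A, measurable A -> nu A = (\int[mu]_(x in A) (g x)%:E)%E.
Import HBNNSimple.
Local Open Scope ereal_scope.

Let nnsfun_density (f : {nnsfun T >-> R}) :
  \int[nu]_x (f x)%:E = \int[mu]_x ((f x)%:E * (g x)%:E).
Proof.
under eq_integral do rewrite fimfunE -fsumEFin//.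
rewrite ge0_integral_fsum//; last 2 first.
- by move=> r; exact/measurable_EFinP/measurable_funM.
- by move=> n x _; rewrite EFinM nnfun_muleindic_ge0.
under [RHS]eq_integral.
  move=> x _; rewrite fimfunE -fsumEFin// ge0_mule_fsuml; last first.
    by move=> r; rewrite EFinM nnfun_muleindic_ge0.
  over.
rewrite [RHS]ge0_integral_fsum//; last 2 first.
- move=> r; apply: emeasurable_funM; apply/measurable_EFinP => //.
  exact: measurable_funM.
- move=> n x _; rewrite mule_ge0 ?lee_fin//.
  by rewrite -lee_fin EFinM nnfun_muleindic_ge0.
apply: eq_fsbigr => r /[!inE] -[x _ <-].
under [RHS]eq_integral do rewrite EFinM -muleA.
rewrite [RHS]ge0_integralZl//; last 3 first.
- by apply: emeasurable_funM => //; exact/measurable_EFinP.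
- by move=> y _; rewrite mule_ge0// lee_fin.
- by rewrite lee_fin.
under [LHS]eq_integral do rewrite EFinM.
rewrite [LHS]ge0_integralZl//; last 2 first.
- exact/measurable_EFinP.
- by rewrite lee_fin.
congr (_ * _); rewrite integral_indic// setIT nuE//.
rewrite integral_mkcond; apply: eq_integral => y _.
by rewrite patchE indicE; case: ifPn => _; rewrite ?mul1e ?mul0e.
Qed.

Lemma ge0_integral_density (f : T -> \bar R) :
  measurable_fun setT f -> (forall x, 0 <= f x) ->
  \int[nu]_x f x = \int[mu]_x (f x * (g x)%:E).
Proof.
move=> mf f0; pose f_ := nnsfun_approx measurableT mf.
have fE x : f x = limn (fun n => (f_ n x)%:E).
  by apply/esym/cvg_lim => //; exact: cvg_nnsfun_approx.
have fnd x : nondecreasing_seq (fun n => (f_ n x)%:E).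
  by move=> m n mn; rewrite lee_fin; exact/lefP/nd_nnsfun_approx.
under eq_integral do rewrite fE.
rewrite monotone_convergence//; last 2 first.
- by move=> n; exact/measurable_EFinP.
- by move=> n x _; rewrite lee_fin.
transitivity (\int[mu]_x limn (fun n => (f_ n x)%:E * (g x)%:E)).
  rewrite monotone_convergence//.
  - by apply: congr_lim; apply/funext => n; exact: nnsfun_density.
  - by move=> n; apply: emeasurable_funM => //; exact/measurable_EFinP.
  - by move=> n x _; rewrite mule_ge0// lee_fin.
  - by move=> x _ m n mn; apply: lee_wpmul2r; [rewrite lee_fin|exact: fnd].
apply: eq_integral => x _; rewrite fE.
by rewrite limeMr//; exact/ereal_nondecreasing_is_cvgn/fnd.
Qed.

End density.

Section gaussian_moments.
Local Open Scope classical_set_scope.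
Context (R : realType).
Local Notation mu := (@lebesgue_measure R).
Local Notation W := (normal_prob (0 : R) 1).

Lemma ge0_integral_normal_prob (m s : R) (f : R -> \bar R) :
  measurable_fun setT f -> (forall x, 0 <= f x)%E ->
  (\int[normal_prob m s]_x f x = \int[mu]_x (f x * (normal_pdf m s x)%:E))%E.
Proof.
move=> mf f0; apply: ge0_integral_density => //.
- exact: measurable_normal_pdf.
- exact: normal_pdf_ge0.
Qed.

(** N(v, s²) is the law of v + s Z for Z standard normal. Continuity of [f] is
    what the substitution rule for Lebesgue integrals asks for. *)
Lemma ge0_integral_normalR (v s : R) (f : R -> R) : 0 < s ->
  continuous f -> (forall x, 0 <= f x) ->
  (\int[normalR v s]_x (f x)%:E = \int[W]_z (f (v + s * z))%:E)%E.
Proof.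
move=> s0 cf f0.
have cF : continuous (fun z : R => v + s * z).
  move=> z; apply: cvgD; first exact: cvg_cst.
  by apply: cvgM; [exact: cvg_cst|exact: cvg_id].
have cfF : continuous (fun z : R => f (v + s * z)).
  by move=> z; apply: continuous_comp; [exact: cF|exact: cf].
have mf : measurable_fun setT f by exact: continuous_measurable_fun.
have mfF : measurable_fun setT (fun z : R => f (v + s * z)).
  exact: continuous_measurable_fun.
rewrite ge0_integral_distribution; last 2 first.
- exact/measurable_EFinP.
- by move=> y; rewrite lee_fin.
rewrite ge0_integral_normal_prob; last 2 first.
- exact/measurable_EFinP.
- by move=> y; rewrite lee_fin.
rewrite ge0_integral_normal_prob; last 2 first.
- exact/measurable_EFinP.
- by move=> y; rewrite lee_fin.
under eq_integral do rewrite -EFinM.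
have F'E : (fun z : R => v + s * z)^`()%classic = cst s.
  apply/funext => z; rewrite derive1E deriveD// derive_cst add0r.
  rewrite deriveM// derive_cst derive_id.
  by rewrite scaler0 addr0 /GRing.scale /= mulr1.
rewrite (@increasing_ge0_integration_by_substitutionT R
  (fun z => v + s * z) (fun x => f x * normal_pdf v s x)); last 9 first.
- by move=> x y xy; rewrite ltrD2l ltr_pM2l.
- by rewrite F'E => ?; exact: cvg_cst.
- by rewrite F'E; exact: is_cvg_cst.
- by rewrite F'E; exact: is_cvg_cst.
- by move=> x; apply: derivableD.
- by apply: cvg_comp (cvg_addrl_Ny v); apply/gt0_cvgMrNy.
- by apply: cvg_comp (cvg_addrl v); apply/gt0_cvgMry.
- move=> x; apply: cvgM; first exact: cf.
  by apply: continuous_normal_pdf; rewrite gt_eqF.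
- by move=> x; rewrite mulr_ge0// normal_pdf_ge0.
apply: eq_integral => z _; rewrite F'E/= -EFinM; congr EFin.
rewrite !fctE -mulrA; congr (_ * _).
rewrite !normal_pdfE ?gt_eqF// /normal_peak /normal_fun.
have -> : s ^+ 2 * pi *+ 2 = s ^+ 2 * (1 ^+ 2 * pi *+ 2).
  by rewrite expr1n mul1r mulrnAr.
rewrite (sqrtrM _ (sqr_ge0 s)) sqrtr_sqr gtr0_norm// invfM.
rewrite [RHS]mulrC [LHS]mulrC !mulrA divff ?gt_eqF// mul1r mulrC.
congr (expR _ * _); rewrite addrC addKr subr0; field.
by rewrite gt_eqF.
Qed.

Lemma normal_prob_sym (A : set R) : measurable A ->
  pushforward W (-%R : _ -> measurableTypeR R) A = W A.
Proof.
move=> mA.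
transitivity (\int[pushforward mu (-%R : _ -> measurableTypeR R)]_(x in A)
    (normal_pdf 0 1 (- x))%:E)%E.
  rewrite ge0_integral_pushforward//.
  - by apply: eq_integral => x _ /=; rewrite opprK.
  - apply/measurable_EFinP; apply: measurable_funTS.
    apply: measurableT_comp => //.
    exact: measurable_normal_pdf.
  - by move=> x _; rewrite lee_fin normal_pdf_ge0.
rewrite (eq_measure_integral mu); last first.
  by move=> B mB _; exact: lebesgue_measureN.
apply: eq_integral => x _; congr EFin.
by rewrite !normal_pdfE ?oner_eq0// /normal_fun !subr0 sqrrN.
Qed.

(** The density of N(0, 1) times x⁴ is bounded by a multiple of the density of
    N(0, 4): with y = x² / 8 their exponents differ by 3 y, and exp(3 y) >= y². *)
Lemma integrable_normal_X4 : W.-integrable setT (fun z : R => (z ^+ 4)%:E).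
Proof.
apply/integrableP; split.
  by apply/measurable_EFinP; exact: measurable_funX.
under eq_integral do rewrite /= ger0_norm ?exprn_even_ge0//.
rewrite ge0_integral_normal_prob; last 2 first.
- by apply/measurable_EFinP; exact: measurable_funX.
- by move=> x; rewrite lee_fin exprn_even_ge0.
pose K := 64 * (normal_peak 1 / normal_peak 2) : R.
have K0 : 0 <= K by rewrite mulr_ge0// divr_ge0// normal_peak_ge0.
apply: (@le_lt_trans _ _
  (\int[mu]_x (K%:E * (normal_pdf 0 2 x)%:E)))%E; last first.
  rewrite integralZl//; last exact: integrable_normal_pdf.
  by rewrite integral_normal_pdf mule1 ltry.
apply: ge0_le_integral => //.
- move=> x _; rewrite -EFinM lee_fin.
  by rewrite mulr_ge0 ?exprn_even_ge0 ?normal_pdf_ge0.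
- apply: emeasurable_funM; apply/measurable_EFinP; first exact: measurable_funX.
  exact: measurable_normal_pdf.
- apply: emeasurable_funM => //; apply/measurable_EFinP.
  exact: measurable_normal_pdf.
move=> x _; rewrite -!EFinM lee_fin !normal_pdfE ?oner_eq0 ?pnatr_eq0//.
rewrite /normal_fun !subr0.
have p2 : 0 < normal_peak (2 : R) by rewrite normal_peak_gt0// pnatr_eq0.
have -> : K * (normal_peak 2 * expR (- x ^+ 2 / (2 ^+ 2 *+ 2))) =
   normal_peak 1 * (64 * expR (- x ^+ 2 / (2 ^+ 2 *+ 2))).
  by rewrite /K; field; rewrite gt_eqF.
rewrite mulrCA ler_wpM2l ?normal_peak_ge0//.
have -> : - x ^+ 2 / (1 ^+ 2 *+ 2) =
    - x ^+ 2 / (2 ^+ 2 *+ 2) - 3 * (x ^+ 2 / 8).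
  by field.
rewrite expRB mulrCA mulrC ler_wpM2r ?expR_ge0//.
rewrite ler_pdivrMr ?expR_gt0//.
set y := x ^+ 2 / 8.
have -> : x ^+ 4 = 64 * y ^+ 2 by rewrite /y; field.
rewrite ler_pM2l//.
have y0 : 0 <= y by rewrite divr_ge0// sqr_ge0.
have y1 : 1 + y <= expR y := expR_ge1Dx y.
have -> : expR (3 * y) = expR y ^+ 3 by rewrite -expRM_natl.
nra.
Qed.

Definition normal_moment k : R := fine (\int[W]_z (z ^+ k)%:E)%E.

Lemma integrable_normal_Xn k : (k <= 4)%N ->
  W.-integrable setT (fun z : R => (z ^+ k)%:E).
Proof.
move=> k4; apply: (@le_integrable _ _ _ W setT _ _
  (fun z : R => 1%:E + (z ^+ 4)%:E)%E) => //.
- by apply/measurable_EFinP; exact: measurable_funX.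
- move=> z _; rewrite -EFinD /= lee_fin normrX.
  rewrite [leRHS]ger0_norm ?addr_ge0 ?exprn_even_ge0//.
  have -> : z ^+ 4 = `|z| ^+ 4 by rewrite -normrX ger0_norm// exprn_even_ge0.
  have [z1|z1] := leP `|z| 1.
    by rewrite (@le_trans _ _ 1) ?exprn_ile1// lerDl exprn_ge0.
  by rewrite (@le_trans _ _ (`|z| ^+ 4)) ?lerDr// ler_weXn2l// ltW.
- apply: integrableD => //; first exact: finite_measure_integrable_cst.
  exact: integrable_normal_X4.
Qed.

Lemma integral_normal_Xn k : (k <= 4)%N ->
  (\int[W]_z (z ^+ k)%:E = (normal_moment k)%:E)%E.
Proof.
move=> k4; rewrite fineK//; apply: integrable_fin_num => //.
exact: integrable_normal_Xn.
Qed.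

Lemma normal_moment0 : normal_moment 0 = 1.
Proof.
rewrite /normal_moment; under eq_integral do rewrite expr0.
by rewrite integral_cst//= probability_setT mule1.
Qed.

Lemma normal_moment_odd k : (k <= 4)%N -> odd k -> normal_moment k = 0.
Proof.
move=> k4 ok; have ik := integrable_normal_Xn k4.
suff : normal_moment k = - normal_moment k by lra.
apply: EFin_inj; rewrite EFinN -integral_normal_Xn//.
transitivity (\int[pushforward W (-%R : _ -> measurableTypeR R)]_z
    (z ^+ k)%:E)%E.
  by apply: eq_measure_integral => A mA _; exact/esym/normal_prob_sym.
have Xk (z : R) : ((- z) ^+ k)%:E = ((-1)%:E * (z ^+ k)%:E)%E.
  by rewrite exprNn -signr_odd ok expr1 EFinM.
have mXk : measurable_fun setT (fun z : R => (z ^+ k)%:E).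
  by apply/measurable_EFinP; exact: measurable_funX.
rewrite integral_pushforward// preimage_setT.
- under eq_integral do rewrite /= Xk.
  by rewrite integralZl// EFinN mulN1e.
- rewrite [X in W.-integrable _ X](_ : _ =
    fun z : R => (-1)%:E * (z ^+ k)%:E)%E.
    exact: integrableZl.
  by apply/funext => z /=; exact: Xk.
Qed.

Lemma integral_normal_quartic (a0 a1 a2 a3 a4 : R) :
  (\int[W]_z (a0 + a1 * z + a2 * z ^+ 2 + a3 * z ^+ 3 + a4 * z ^+ 4)%:E =
   (a0 + a2 * normal_moment 2 + a4 * normal_moment 4)%:E)%E.
Proof.
pose a := [:: a0; a1; a2; a3; a4].
under eq_integral.
  move=> z _.
  rewrite (_ : (_ + _) = \sum_(k < 5) a`_k * z ^+ k); last first.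
    by rewrite !big_ord_recr big_ord0 /= add0r expr0 expr1 mulr1.
  rewrite -sumEFin; under eq_bigr do rewrite EFinM.
  over.
rewrite integral_sum//; last first.
  move=> k; apply: integrableZl => //.
  by apply: integrable_normal_Xn; rewrite -ltnS.
transitivity (\sum_(k < 5) (a`_k * normal_moment k)%:E)%E.
  apply: eq_bigr => k _; rewrite integralZl//; last first.
    by apply: integrable_normal_Xn; rewrite -ltnS.
  by rewrite integral_normal_Xn// -ltnS.
rewrite sumEFin !big_ord_recr big_ord0 /= normal_moment0.
by rewrite (@normal_moment_odd 1)// (@normal_moment_odd 3)//; congr EFin; ring.
Qed.

Lemma integral_normalR_sqr (s : R) : 0 < s ->
  (\int[normalR 0 s]_x (x ^+ 2)%:E = (s ^+ 2 * normal_moment 2)%:E)%E.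
Proof.
move=> s0; rewrite ge0_integral_normalR//; last 2 first.
- exact: exprn_continuous.
- exact: sqr_ge0.
transitivity (\int[W]_z
    (0 + 0 * z + s ^+ 2 * z ^+ 2 + 0 * z ^+ 3 + 0 * z ^+ 4)%:E)%E.
  by apply: eq_integral => z _; congr EFin; ring.
by rewrite integral_normal_quartic; congr EFin; ring.
Qed.

(** The mean and the variance of one squared coordinate, in the form that
    [integral_sqr_sum_tnth] asks for. *)
Lemma integral_normalR_centered_sqr (v s c : R) : 0 < s ->
  (\int[normalR v s]_x
     ((c + (x ^+ 2 - v ^+ 2 - s ^+ 2 * normal_moment 2)) ^+ 2)%:E =
   (c ^+ 2 + (4 * normal_moment 2 * s ^+ 2 * v ^+ 2 +
              (normal_moment 4 - normal_moment 2 ^+ 2) * s ^+ 4))%:E)%E.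
Proof.
move=> s0; set m2 := normal_moment 2.
have cq : continuous (fun x : R => c + (x ^+ 2 - v ^+ 2 - s ^+ 2 * m2)).
  move=> x; apply: cvgD; first exact: cvg_cst.
  do 2 (apply: cvgB; last exact: cvg_cst).
  exact: exprn_continuous.
rewrite (@ge0_integral_normalR _ _
  (fun x => (c + (x ^+ 2 - v ^+ 2 - s ^+ 2 * m2)) ^+ 2))//; last 2 first.
- move=> x; exact: (@continuous_comp _ _ _ _ (fun y : R => y ^+ 2) x (cq x)
    (@exprn_continuous R 2 _)).
- by move=> x; exact: sqr_ge0.
(* At x = v + s z the base of the square is e + 2 v s z + s² z². *)
pose e := c - s ^+ 2 * m2.
transitivity (\int[W]_z (e ^+ 2 + 4 * v * s * e * z +
    (4 * v ^+ 2 * s ^+ 2 + 2 * e * s ^+ 2) * z ^+ 2 +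
    4 * v * s ^+ 3 * z ^+ 3 + s ^+ 4 * z ^+ 4)%:E)%E.
  by apply: eq_integral => z _; congr EFin; rewrite /e; ring.
by rewrite integral_normal_quartic; congr EFin; rewrite /e /m2; ring.
Qed.

End gaussian_moments.

(** * Mean and variance of the statistic *)

Section chi2_moments.
Local Open Scope classical_set_scope.
Context (R : realType) (d : nat).
Local Notation m2 := (@normal_moment R 2).
Local Notation m4 := (@normal_moment R 4).

Lemma expectation_sqnorm2_gauss0 (s : R) : 0 < s ->
  ('E_(gauss [tuple 0%R | _ < d] s)[@sqnorm2 R d] =
   (d%:R * (s ^+ 2 * m2))%:E)%E.
Proof.
move=> s0; rewrite unlock.
transitivity (\int[gauss [tuple 0%R | _ < d] s]_x
    (0 + \sum_(i < d) tnth x i ^+ 2)%:E)%E.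
  by apply: eq_integral => x _; rewrite add0r.
rewrite (@ge0_integral_sum_tnth _ _ _ _ _
  (fun _ (x : R) => x ^+ 2) (fun _ => s ^+ 2 * m2))//.
- by rewrite add0r sumr_const card_ord mulr_natl.
- by move=> i x; exact: sqr_ge0.
- by move=> i; rewrite tnth_mktuple integral_normalR_sqr.
Qed.

Lemma T2E (s : R) (x : d.-tuple R) : 0 < s ->
  T2 s x = sqnorm2 x - d%:R * (s ^+ 2 * m2).
Proof. by move=> s0; rewrite /T2 expectation_sqnorm2_gauss0. Qed.

Lemma measurable_T2 (s : R) : measurable_fun setT (@T2 R d s).
Proof.
apply: measurable_funB => //.
apply: (@measurable_sum_tnth _ _ _ _ (fun _ (y : R) => y ^+ 2)) => i.
exact: measurable_funX.
Qed.

(** Subtracting the mean of ‖X‖₂² under P_0 leaves T2 with mean ‖v‖₂² under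
    P_v, so this is the variance of T2. *)
Lemma integral_T2_centered_sqr (s : R) (v : d.-tuple R) : 0 < s ->
  (\int[gauss v s]_x ((T2 s x - sqnorm2 v) ^+ 2)%:E =
   (4 * m2 * s ^+ 2 * sqnorm2 v + d%:R * ((m4 - m2 ^+ 2) * s ^+ 4))%:E)%E.
Proof.
move=> s0.
pose g i (x : R) := x ^+ 2 - tnth v i ^+ 2 - s ^+ 2 * m2.
transitivity (\int[gauss v s]_x ((0 + \sum_(i < d) g i (tnth x i)) ^+ 2)%:E)%E.
  apply: eq_integral => x _; congr ((_ ^+ 2)%:E).
  rewrite T2E// add0r !sumrB sumr_const card_ord mulr_natl.
  by rewrite /sqnorm2 addrAC.
rewrite (@integral_sqr_sum_tnth _ _ _ _ _ g
  (fun i => 4 * m2 * s ^+ 2 * tnth v i ^+ 2 + (m4 - m2 ^+ 2) * s ^+ 4)).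
- rewrite expr0n add0r big_split/= -mulr_sumr sumr_const card_ord.
  by rewrite !mulr_natl.
- by move=> i; do 2 apply: measurable_funB => //.
- by move=> i c; exact: integral_normalR_centered_sqr.
Qed.

End chi2_moments.

(** * Comparison of the norms *)

Section norms.
Context (R : realType).

Lemma sqnorm2_ge0 d (v : d.-tuple R) : 0 <= sqnorm2 v.
Proof. by apply: sumr_ge0 => i _; exact: sqr_ge0. Qed.

Lemma l1norm_ge0 d (v : d.-tuple R) : 0 <= l1norm v.
Proof. exact: sumr_ge0. Qed.

Lemma sqnorm2_le_l1norm d (v : d.-tuple R) : sqnorm2 v <= l1norm v ^+ 2.
Proof.
rewrite expr2 {2}/l1norm mulr_sumr; apply: ler_sum => i _.
rewrite -(real_normK (num_real (tnth v i))) expr2 ler_wpM2r//.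
by rewrite /l1norm (bigD1 i)//= lerDl sumr_ge0.
Qed.

(** Cauchy-Schwarz: expand the sum of the squared deviations of the |v_i| from
    their average r = ‖v‖₁ / d. *)
Lemma l1norm_le_sqnorm2 d (v : d.-tuple R) : l1norm v ^+ 2 <= d%:R * sqnorm2 v.
Proof.
case: d v => [|d] v; first by rewrite /l1norm big_ord0 expr0n mul0r.
set D : R := d.+1%:R; have D0 : 0 < D by rewrite ltr0n.
pose r := l1norm v / D.
have : 0 <= \sum_(i < d.+1) (`|tnth v i| - r) ^+ 2.
  by apply: sumr_ge0 => i _; exact: sqr_ge0.
have -> : \sum_(i < d.+1) (`|tnth v i| - r) ^+ 2 =
    sqnorm2 v - l1norm v * (r *+ 2) + D * r ^+ 2.
  rewrite /sqnorm2 /l1norm mulr_suml -sumrB.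
  rewrite (_ : D * r ^+ 2 = \sum_(i < d.+1) r ^+ 2); last first.
    by rewrite sumr_const card_ord -[RHS]mulr_natl.
  rewrite -big_split; apply: eq_bigr => i _ /=.
  by rewrite sqrrB real_normK ?num_real// mulrnAr.
have -> : l1norm v = D * r by rewrite /r; field; rewrite gt_eqF.
move=> h; have {}h : D * r ^+ 2 <= sqnorm2 v by move: h; rewrite mulr2n; lra.
by rewrite exprMn expr2 -mulrA ler_pM2l.
Qed.

End norms.

(** * Error probabilities of chi-squared tests *)

Section chebyshev.
Local Open Scope classical_set_scope.
Context d (T : measurableType d) (R : realType) (P : probability T R).

(** Chebyshev's inequality, for an arbitrary event on which |X| >= a. *)
Lemma second_moment_tail (X : T -> R) (A : set T) (a delta : R) :
  measurable_fun setT X -> measurable A -> 0 < a ->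
  (forall x, A x -> a <= `|X x|) ->
  (\int[P]_x ((X x) ^+ 2)%:E <= (delta * a ^+ 2)%:E)%E -> (P A <= delta%:E)%E.
Proof.
move=> mX mA a0 aX XV.
have a20 : 0 < a ^+ 2 by rewrite exprn_gt0.
rewrite -(@lee_pmul2l _ (a ^+ 2)%:E) ?lte_fin//.
rewrite -EFinM [leRHS](_ : _ = (delta * a ^+ 2)%:E); last by rewrite mulrC.
apply: le_trans XV; rewrite -integral_cst//.
apply: (@le_trans _ _ (\int[P]_(x in A) (X x ^+ 2)%:E)%E).
  apply: ge0_le_integral => //.
  - by move=> x _; rewrite lee_fin ltW.
  - by apply/measurable_EFinP; apply: measurable_funTS; exact: measurable_funX.
  - move=> x Ax; have h := aX x Ax; rewrite lee_fin.
    by rewrite -[leRHS]real_normK ?num_real//; nra.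
apply: ge0_subset_integral => //.
- by apply/measurable_EFinP; exact: measurable_funX.
- by move=> x _; rewrite lee_fin sqr_ge0.
Qed.

End chebyshev.

Section chi2_error_probabilities.
Local Open Scope classical_set_scope.
Context (R : realType).
Local Notation m2 := (@normal_moment R 2).
Local Notation m4 := (@normal_moment R 4).

(** Absolute values make both coefficients of the variance bounded by
    [noise_const] without any information on the moments. *)
Definition noise_const : R := 1 + 4 * `|m2| + `|m4 - m2 ^+ 2|.
Local Notation B := noise_const.

Lemma noise_const_gt0 : 0 < B.
Proof. by rewrite /B !ltr_wpDr// mulr_ge0. Qed.

(** The square of [chi2_scale] is σ² √d, the order of the standard deviation of
    T2 under P_0. *)
Definition chi2_scale (d : nat) (s : R) : R := s * d%:R `^ (1 / 4).

Section fixed_dimension.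
Variables (d : nat) (s : R).
Hypotheses (d1 : (1 <= d)%N) (s0 : 0 < s).
Local Notation w := (chi2_scale d s).

Lemma powR14_ge1 : 1 <= (d%:R : R) `^ (1 / 4).
Proof.
rewrite [leLHS](_ : _ = 1 `^ (1 / 4)); last by rewrite powR1.
by rewrite ge0_ler_powR ?nnegrE ?ler1n ?divr_ge0.
Qed.

Lemma powR14_X4 : ((d%:R : R) `^ (1 / 4)) ^+ 4 = d%:R.
Proof.
by rewrite -powR_mulrn ?powR_ge0// -powRrM mul1r mulVf ?powRr1 ?pnatr_eq0.
Qed.

Lemma powR34 : (d%:R : R) `^ (3 / 4) = (d%:R `^ (1 / 4)) ^+ 3.
Proof.
by rewrite -powR_mulrn ?powR_ge0// -powRrM mul1r mulrC.
Qed.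

Lemma chi2_scale_gt0 : 0 < w.
Proof. by rewrite mulr_gt0// (lt_le_trans ltr01)// powR14_ge1. Qed.

(** The variance is at most B (σ² N + d σ⁴) with N = ‖v‖₂². Here d σ⁴ = w⁴, and
    σ² <= w² since d >= 1. *)
Lemma T2_second_moment_le (v : d.-tuple R) :
  (\int[gauss v s]_x ((T2 s x - sqnorm2 v) ^+ 2)%:E <=
   (B * (w ^+ 2 * (w ^+ 2 + sqnorm2 v)))%:E)%E.
Proof.
rewrite integral_T2_centered_sqr// lee_fin.
have := powR14_ge1; have := powR14_X4; rewrite /chi2_scale.
set q := _ `^ _ => <- q1; have n0 := sqnorm2_ge0 v.
have h1 : m2 <= `|m2| := ler_norm _.
have h2 : m4 - m2 ^+ 2 <= `|m4 - m2 ^+ 2| := ler_norm _.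
have a0 : 0 <= s ^+ 2 * sqnorm2 v by rewrite mulr_ge0// sqr_ge0.
have b0 : 0 <= q ^+ 4 * s ^+ 4 by rewrite mulr_ge0// exprn_even_ge0.
have q2 : 1 <= q ^+ 2 by rewrite exprn_ege1.
have aq : s ^+ 2 * sqnorm2 v <= q ^+ 2 * (s ^+ 2 * sqnorm2 v).
  by rewrite ler_peMl.
have hB1 : 4 * m2 <= B.
  rewrite /B; have := normr_ge0 (m4 - m2 ^+ 2); lra.
have hB2 : m4 - m2 ^+ 2 <= B.
  rewrite /B; have := normr_ge0 m2; lra.
have B0 := noise_const_gt0.
apply: (@le_trans _ _ (B * (s ^+ 2 * sqnorm2 v) + B * (q ^+ 4 * s ^+ 4))).
  apply: lerD.
    by rewrite -mulrA ler_wpM2r.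
  by rewrite mulrCA ler_wpM2r.
rewrite -mulrDr ler_pM2l//.
have -> : (s * q) ^+ 2 * ((s * q) ^+ 2 + sqnorm2 v) =
    q ^+ 2 * (s ^+ 2 * sqnorm2 v) + q ^+ 4 * s ^+ 4.
  by ring.
by rewrite lerD2r.
Qed.

Lemma measurable_T2_sub (v : d.-tuple R) :
  measurable_fun setT (fun x : d.-tuple R => T2 s x - sqnorm2 v).
Proof. by apply: measurable_funB => //; exact: measurable_T2. Qed.

(** Chebyshev with deviation a = t - ‖v‖₂² >= (1 + k) (w² + r), k = B / delta.
    The variance is at most B w² (w² + r) <= delta k (w² + r)², and
    k <= (1 + k)². *)
Lemma chi2_rejection_le (v : d.-tuple R) (t r delta : R) : 0 < delta ->
  sqnorm2 v <= r -> r + (1 + B / delta) * (w ^+ 2 + r) <= t ->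
  (gauss v s (chi2_test d s t @^-1` [set true]) <= delta%:E)%E.
Proof.
move=> e0 vr rt; have n0 := sqnorm2_ge0 v.
have u0 : 0 < w ^+ 2 by rewrite exprn_gt0// chi2_scale_gt0.
have k0 : 0 < B / delta by rewrite divr_gt0// noise_const_gt0.
set k := B / delta in rt k0.
have Bk : B = delta * k by rewrite /k; field; rewrite gt_eqF.
have kw : 0 < k * (w ^+ 2 + r) by rewrite mulr_gt0//; lra.
apply: (@second_moment_tail _ _ _ _
  (fun x => T2 s x - sqnorm2 v) _ (t - sqnorm2 v)) => //.
- exact: measurable_T2_sub.
- by rewrite -[X in measurable X]setTI; exact: measurable_funP.
- by nra.
- by move=> x /= tx; rewrite (le_trans _ (ler_norm _))// lerD2r.
- apply: le_trans (T2_second_moment_le v) _.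
  rewrite lee_fin Bk -mulrA ler_pM2l//.
  set u := w ^+ 2 in u0 rt kw *; set n := sqnorm2 v in vr n0 *.
  have r0 : 0 <= r by apply: le_trans vr.
  have p0 : 0 <= (1 + k) * (u + r) by nra.
  apply: (@le_trans _ _ (((1 + k) * (u + r)) ^+ 2)); last first.
    by rewrite ler_sqr ?nnegrE; lra.
  rewrite exprMn; apply: ler_pM; [exact: ltW|nra|nra|nra].
Qed.

(** Chebyshev with deviation a = ‖v‖₂² - t >= N / 2, N = ‖v‖₂². As w² <= N, the
    variance is at most 2 B w² N, which is at most delta N² / 4 as soon as
    8 B w² <= delta N. *)
Lemma chi2_acceptance_le (v : d.-tuple R) (t delta : R) : 0 < delta ->
  2 * t <= sqnorm2 v -> (1 + 8 * B / delta) * w ^+ 2 <= sqnorm2 v ->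
  (gauss v s (chi2_test d s t @^-1` [set false]) <= delta%:E)%E.
Proof.
move=> e0 tv uv.
have u0 : 0 < w ^+ 2 by rewrite exprn_gt0// chi2_scale_gt0.
have k0 : 0 < B / delta by rewrite divr_gt0// noise_const_gt0.
rewrite -mulrA in uv.
set k := B / delta in uv k0.
have Bk : B = delta * k by rewrite /k; field; rewrite gt_eqF.
apply: (@second_moment_tail _ _ _ _
  (fun x => T2 s x - sqnorm2 v) _ (sqnorm2 v - t)) => //.
- exact: measurable_T2_sub.
- by rewrite -[X in measurable X]setTI; exact: measurable_funP.
- by nra.
- move=> x /= /negbT; rewrite -ltNge => tx.
  by rewrite distrC (le_trans _ (ler_norm _))// lerD2l lerN2 ltW.
- apply: le_trans (T2_second_moment_le v) _.
  rewrite lee_fin Bk -mulrA ler_pM2l//.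
  set u := w ^+ 2 in u0 uv *; set n := sqnorm2 v in tv uv *.
  have ku : 0 < k * u by rewrite mulr_gt0.
  have un : u <= n by nra.
  apply: (@le_trans _ _ ((n / 2) ^+ 2)); last by rewrite ler_sqr ?nnegrE; lra.
  nra.
Qed.

End fixed_dimension.

Lemma error_probabilities_sum_ge1 d (psi : test R d)
    (P : probability (d.-tuple R) R) (a b : R) :
  (P (psi @^-1` [set true]) <= a%:E)%E ->
  (P (psi @^-1` [set false]) <= b%:E)%E -> 1 <= a + b.
Proof.
move=> Pa Pb; rewrite -lee_fin EFinD; apply: le_trans (leeD Pa Pb).
have mA : measurable (psi @^-1` [set true]).
  by rewrite -[X in measurable X]setTI; exact: measurable_funP.
have -> : psi @^-1` [set false] = ~` (psi @^-1` [set true]).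
  by apply/seteqP; split => x /=; case: (psi x).
by rewrite probability_setC// addeC subeK// fin_num_measure.
Qed.

End chi2_error_probabilities.

(** * Existence and non-existence of good thresholds *)

Section tests.
Context (R : realType).
Local Notation B := (@noise_const R).

(** The smallest threshold that [chi2_rejection_le] allows at level alpha for
    all v with ‖v‖₂ <= eps0, a set that contains the null hypothesis. *)
Definition chi2_threshold (alpha : R) (d : nat) (sigma eps0 eps1 : R) : R :=
  eps0 ^+ 2 + (1 + B / alpha) * (chi2_scale d sigma ^+ 2 + eps0 ^+ 2).

Lemma chi2_threshold_valid (alpha : R) d (sigma eps0 eps1 : R) : 0 < alpha ->
  (1 <= d)%N -> 0 < sigma -> 0 <= eps0 ->
  valid alpha sigma eps0
    (chi2_test d sigma (chi2_threshold alpha d sigma eps0 eps1)).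
Proof.
move=> a0 d1 s0 e0; apply: ge_ereal_sup => _ [v /= ve <-].
apply: (@chi2_rejection_le _ _ _ d1 s0 _ _ (eps0 ^+ 2)) => //.
apply: le_trans (sqnorm2_le_l1norm v) _.
by rewrite ler_sqr ?nnegrE// l1norm_ge0.
Qed.

(** If eps0 <= w the threshold is at most (1 + 2 k) w² with k = 1 + B / alpha,
    whereas Cauchy-Schwarz gives ‖v‖₂² >= K² w² >= K w² on the alternative. The
    two parts of the bound on [K] answer the two demands of
    [chi2_acceptance_le]. *)
Lemma chi2_threshold_powerful (alpha beta K : R) d (sigma eps0 eps1 : R) :
  0 < alpha -> 0 < beta -> (1 <= d)%N -> 0 < sigma -> 0 <= eps0 ->
  2 + 4 * (1 + B / alpha) + (1 + 8 * B / beta) <= K ->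
  K * sigma * d%:R `^ (3 / 4) <= eps1 - eps0 ->
  eps0 <= sigma * d%:R `^ (1 / 4) ->
  powerful beta sigma eps1
    (chi2_test d sigma (chi2_threshold alpha d sigma eps0 eps1)).
Proof.
move=> a0 b0 d1 s0 e0 hK h1 h2; apply: ge_ereal_sup => _ [v /= ve <-].
have k0 : 0 < B / alpha by rewrite divr_gt0// noise_const_gt0.
have N0 : 0 < 8 * B / beta by rewrite divr_gt0// mulr_gt0// noise_const_gt0.
have K1 : 1 <= K by lra.
have q1 := @powR14_ge1 R d d1; have w0 := chi2_scale_gt0 d1 s0.
have vK : K * chi2_scale d sigma ^+ 2 <= sqnorm2 v.
  have := l1norm_le_sqnorm2 v; rewrite -(powR14_X4 R d).
  rewrite powR34 in h1; rewrite /chi2_scale in w0 *.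
  set q := _ `^ _ in q1 w0 h1 *; have q0 : 0 < q by lra.
  move=> lv; rewrite -(@ler_pM2l _ (q ^+ 4)) ?exprn_gt0//; apply: le_trans lv.
  apply: (@le_trans _ _ ((K * sigma * q ^+ 3) ^+ 2)).
    have -> : q ^+ 4 * (K * (sigma * q) ^+ 2) =
        K * (sigma * q ^+ 3) ^+ 2 by ring.
    have -> : (K * sigma * q ^+ 3) ^+ 2 =
        K ^+ 2 * (sigma * q ^+ 3) ^+ 2 by ring.
    by rewrite ler_wpM2r ?sqr_ge0//; nra.
  have K0 : 0 <= K * sigma * q ^+ 3.
    by rewrite !mulr_ge0 ?exprn_ge0 ?ltW//; lra.
  by rewrite ler_sqr ?nnegrE ?l1norm_ge0//; lra.
have ew : eps0 ^+ 2 <= chi2_scale d sigma ^+ 2.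
  by rewrite ler_sqr ?nnegrE// ltW.
have u0 : 0 < chi2_scale d sigma ^+ 2 by rewrite exprn_gt0.
apply: chi2_acceptance_le => //; last first.
  by apply: le_trans vK; rewrite ler_wpM2r ?ltW//; lra.
apply: le_trans vK; rewrite /chi2_threshold.
set k := B / alpha in k0 hK *; set u := _ ^+ 2 in u0 ew *.
apply: (@le_trans _ _ ((2 + 4 * (1 + k)) * u)); first nra.
by rewrite ler_wpM2r ?ltW//; lra.
Qed.

(** The spike and the flat vector have the largest and the smallest Euclidean
    norm among the vectors of given l1 norm. *)
Definition spike (d : nat) (e : R) : d.-tuple R :=
  [tuple (if (i == 0 :> nat)%N then e else 0) | i < d].

Definition flat (d : nat) (e : R) : d.-tuple R := [tuple e / d%:R | _ < d].

Lemma l1norm_spike d e : (1 <= d)%N -> 0 <= e -> l1norm (spike d e) = e.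
Proof.
case: d => // d _ e0; rewrite /l1norm big_ord_recl tnth_mktuple ger0_norm//.
by rewrite big1 ?addr0// => i _; rewrite tnth_mktuple normr0.
Qed.

Lemma sqnorm2_spike d e : (1 <= d)%N -> sqnorm2 (spike d e) = e ^+ 2.
Proof.
case: d => // d _; rewrite /sqnorm2 big_ord_recl tnth_mktuple.
by rewrite big1 ?addr0// => i _; rewrite tnth_mktuple expr0n.
Qed.

Lemma l1norm_flat d e : (1 <= d)%N -> 0 <= e -> l1norm (flat d e) = e.
Proof.
move=> d1 e0; rewrite /l1norm.
under eq_bigr do rewrite tnth_mktuple ger0_norm ?divr_ge0//.
by rewrite sumr_const card_ord -[LHS]mulr_natr divfK// pnatr_eq0 -lt0n.
Qed.

Lemma sqnorm2_flat d e : (1 <= d)%N -> sqnorm2 (flat d e) = e ^+ 2 / d%:R.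
Proof.
move=> d1; rewrite /sqnorm2.
under eq_bigr do rewrite tnth_mktuple.
rewrite sumr_const card_ord -[LHS]mulr_natr; field.
by rewrite pnatr_eq0 -lt0n.
Qed.

(** The spike lies in the null hypothesis and the flat vector in the
    alternative, but the squared norm of the former is at least C w² and that of
    the latter at most M w², so no [t] can tell them apart in the right
    direction. The lower bound on [C] makes eps0² / 2 exceed what
    [chi2_rejection_le] asks of a threshold for accepting the flat vector, and
    eps0² what [chi2_acceptance_le] asks for rejecting the spike; the levels
    (1 - alpha) / 2 and (1 - beta) / 2 leave room for a contradiction. *)
Lemma no_chi2_threshold (alpha beta c C : R) d (sigma eps0 eps1 t : R) :
  alpha < 1 -> beta < 1 -> (1 <= d)%N -> 0 < sigma -> 0 <= eps0 -> 0 <= eps1 ->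
  let M := c ^+ 2 in
  1 + 2 * (M + (1 + B / ((1 - beta) / 2)) * (1 + M)) +
    (1 + 8 * B / ((1 - alpha) / 2)) <= C ->
  eps1 <= c * sigma * d%:R `^ (3 / 4) ->
  C * sigma * d%:R `^ (1 / 4) <= eps0 ->
  valid alpha sigma eps0 (chi2_test d sigma t) ->
  powerful beta sigma eps1 (chi2_test d sigma t) -> False.
Proof.
move=> a1 b1 d1 s0 e0 e10 M hC h1 h0 val pow.
set da := (1 - alpha) / 2 in hC; set db := (1 - beta) / 2 in hC.
have da0 : 0 < da by rewrite /da; lra.
have db0 : 0 < db by rewrite /db; lra.
have k0 : 0 < B / db by rewrite divr_gt0// noise_const_gt0.
have N0 : 0 < 8 * B / da by rewrite divr_gt0// mulr_gt0// noise_const_gt0.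
have M0 : 0 <= M := sqr_ge0 c.
have q1 := @powR14_ge1 R d d1; have w0 := chi2_scale_gt0 d1 s0.
have u0 : 0 < chi2_scale d sigma ^+ 2 by rewrite exprn_gt0.
set k := B / db in hC k0; set N := 8 * B / da in hC N0.
have kM : 0 <= k * M by rewrite mulr_ge0// ltW.
have C1 : 1 <= C by nra.
have Ce : C * chi2_scale d sigma ^+ 2 <= eps0 ^+ 2.
  apply: (@le_trans _ _ ((C * chi2_scale d sigma) ^+ 2)).
    by rewrite [leRHS]exprMn ler_wpM2r ?ltW//; nra.
  rewrite ler_sqr ?nnegrE//; first by rewrite mulrA.
  by rewrite mulr_ge0 ?ltW//; lra.
have [te|te] := leP (2 * t) (eps0 ^+ 2).
  have acc : (gauss (spike d eps0) sigma
      (chi2_test d sigma t @^-1` [set false])%classic <= da%:E)%E.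
    apply: chi2_acceptance_le => //; rewrite sqnorm2_spike//.
    by apply: le_trans Ce; rewrite ler_wpM2r ?ltW// -/N; nra.
  have rej : (gauss (spike d eps0) sigma
      (chi2_test d sigma t @^-1` [set true])%classic <= alpha%:E)%E.
    apply: le_trans val; apply: ereal_sup_ubound.
    by exists (spike d eps0) => //=; rewrite l1norm_spike.
  by have := error_probabilities_sum_ge1 rej acc; rewrite /da; lra.
have rej : (gauss (flat d eps1) sigma
    (chi2_test d sigma t @^-1` [set true])%classic <= db%:E)%E.
  apply: (@chi2_rejection_le _ _ _ d1 s0 _ _
    (M * chi2_scale d sigma ^+ 2)) => //.
    rewrite sqnorm2_flat// ler_pdivrMr ?ltr0n//.
    rewrite -(powR14_X4 R d); rewrite powR34 in h1; rewrite /chi2_scale.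
    set q := _ `^ _ in q1 h1 *.
    have -> : M * (sigma * q) ^+ 2 * q ^+ 4 = (c * sigma * q ^+ 3) ^+ 2.
      by rewrite /M; ring.
    by rewrite ler_sqr ?nnegrE// (le_trans e10).
  rewrite -/k; set u := _ ^+ 2 in u0 Ce *.
  have : (1 + 2 * (M + (1 + k) * (1 + M))) * u <= C * u.
    by rewrite ler_wpM2r ?ltW//; lra.
  nra.
have acc : (gauss (flat d eps1) sigma
    (chi2_test d sigma t @^-1` [set false])%classic <= beta%:E)%E.
  apply: le_trans pow; apply: ereal_sup_ubound.
  by exists (flat d eps1) => //=; rewrite l1norm_flat.
by have := error_probabilities_sum_ge1 rej acc; rewrite /db; lra.
Qed.

End tests.

Theorem lemma1 (R : realType) (alpha beta : R)
    (halpha : 0 < alpha < 1) (hbeta : 0 < beta < 1 - alpha) :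
  (exists tstar : nat -> R -> R -> R -> R,
    (forall (d : nat) (sigma eps0 eps1 : R),
      (1 <= d)%N -> 0 < sigma <= 1 -> 0 <= eps0 <= eps1 ->
      valid alpha sigma eps0 (chi2_test d sigma (tstar d sigma eps0 eps1))) /\
    exists C1 K1 : R, [/\ 0 < C1, 0 < K1 &
      forall (d : nat) (sigma eps0 eps1 : R),
        (1 <= d)%N -> 0 < sigma <= 1 -> 0 <= eps0 <= eps1 ->
        K1 * sigma * d%:R `^ (3 / 4) <= eps1 - eps0 ->
        eps0 <= C1 * sigma * d%:R `^ (1 / 4) ->
        powerful beta sigma eps1
          (chi2_test d sigma (tstar d sigma eps0 eps1))]) /\
  (forall c1 c2 c3 : R, 0 < c1 -> 0 < c2 -> 0 < c3 ->
    exists2 C2 : R, 0 < C2 &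
      forall (d : nat) (sigma eps0 eps1 : R),
        (1 <= d)%N -> 0 < sigma <= 1 -> 0 <= eps0 <= eps1 ->
        c1 * sigma * d%:R `^ (3 / 4) <= eps1 - eps0
          <= c2 * sigma * d%:R `^ (3 / 4) ->
        C2 * sigma * d%:R `^ (1 / 4) <= eps0
          <= c3 * sigma * d%:R `^ (3 / 4) ->
        ~ exists t : R,
            valid alpha sigma eps0 (chi2_test d sigma t) /\
            powerful beta sigma eps1 (chi2_test d sigma t)).
Proof.
have [a0 a1] := andP halpha; have [b0 ba] := andP hbeta.
have B0 := @noise_const_gt0 R.
have ka : 0 < noise_const R / alpha by rewrite divr_gt0.
split.
  exists (chi2_threshold alpha); split.
    move=> d s e0 e1 d1 /andP[s0 _] /andP[e00 _].
    exact: chi2_threshold_valid.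
  have Nb : 0 < 8 * noise_const R / beta by rewrite divr_gt0// mulr_gt0.
  exists 1,
    (2 + 4 * (1 + noise_const R / alpha) + (1 + 8 * noise_const R / beta)).
  split=> [//||d s e0 e1 d1 /andP[s0 _] /andP[e00 _] h1 h2]; first lra.
  by apply: chi2_threshold_powerful h1 _ => //; rewrite -[s]mul1r.
move=> c1 c2 c3 c10 c20 c30.
exists (1 + 2 * ((c2 + c3) ^+ 2 +
      (1 + noise_const R / ((1 - beta) / 2)) * (1 + (c2 + c3) ^+ 2)) +
    (1 + 8 * noise_const R / ((1 - alpha) / 2))).
  have b1 : 0 < noise_const R / ((1 - beta) / 2) by rewrite !divr_gt0//; lra.
  have a2 : 0 < 8 * noise_const R / ((1 - alpha) / 2).
    by rewrite !divr_gt0 ?mulr_gt0//; lra.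
  have c0 := sqr_ge0 (c2 + c3).
  move: (_ ^+ 2) c0 (_ / _) b1 (_ / _) a2 => M M0 k k0 N N0.
  nra.
move=> d s e0 e1 d1 /andP[s0 _] /andP[e00 e01] /andP[_ h1] /andP[h2 h3].
move=> [t [v p]].
apply: (@no_chi2_threshold R alpha beta (c2 + c3) _ d s e0 e1 t) v p => //.
- lra.
- exact: le_trans e01.
- by rewrite (mulrDl c2) mulrDl; lra.
Qed.
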